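(* For a non-empty partition $\pi$ let $\pi_1$ be its largest part, $\ell(\pi)$ its number of parts and $\Gamma(\pi)=\pi_1+\ell(\pi)-1$. Let $\mathcal{P}$, $\mathcal{D}$, $\mathcal{O}$ denote respectively the sets of all non-empty partitions, non-empty partitions into distinct parts, and non-empty partitions into odd parts. Then, as formal power series, $$\sum_{\pi\in\mathcal{P}}x^{\pi_1}y^{\ell(\pi)}q^{\Gamma(\pi)}=\frac{xyq}{1-(xq+yq)},\qquad \sum_{\pi\in\mathcal{D}}x^{\pi_1}y^{\ell(\pi)}q^{\Gamma(\pi)}=\frac{xyq}{1-(xq+xyq^2)},$$ $$\sum_{\pi\in\mathcal{O}}x^{\pi_1}y^{\ell(\pi)}q^{\Gamma(\pi)}=\frac{xyq}{1-(yq+x^2q^2)}.$$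
   Context: Partitions are finite non-increasing sequences of positive integers; the empty partition is excluded. $\Gamma(\pi)=\pi_1+\ell(\pi)-1$ is the length of the largest hook of $\pi$. *)

(* Defs.v *)
From HB Require Import structures.
From mathcomp Require Import all_boot all_order all_algebra.
From mathcomp Require Import boolp classical_sets cardinality fsbigop.

Set Implicit Arguments.
Unset Strict Implicit.
Unset Printing Implicit Defensive.

Import GRing.Theory.
Local Open Scope ring_scope.

Record fps (R : Type) := FPS { fps_coef : nat -> R }.

HB.instance Definition _ (R : Type) := gen_eqMixin (fps R).
HB.instance Definition _ (R : Type) := gen_choiceMixin (fps R).

Lemma fpsP (R : Type) (f g : fps R) :
  (forall n, fps_coef f n = fps_coef g n) -> f = g.
Proof. by case: f => f; case: g => g /= fg; congr FPS; apply: funext. Qed.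

Section FpsRing.
Variable R : comNzRingType.
Implicit Types f g h : fps R.

Definition fps_const (c : R) : fps R := FPS (fun n => if n == 0 then c else 0).
Definition fps_var : fps R := FPS (fun n => (n == 1)%:R).

Definition fps_opp f : fps R := FPS (fun n => - fps_coef f n).
Definition fps_add f g : fps R := FPS (fun n => fps_coef f n + fps_coef g n).
Definition fps_mul f g : fps R :=
  FPS (fun n => \sum_(i < n.+1) fps_coef f i * fps_coef g (n - i)%N).

Lemma fps_addA : associative fps_add.
Proof. by move=> f g h; apply: fpsP => n /=; rewrite addrA. Qed.
Lemma fps_addC : commutative fps_add.
Proof. by move=> f g; apply: fpsP => n /=; rewrite addrC. Qed.
Lemma fps_add0 : left_id (fps_const 0) fps_add.
Proof. by move=> f; apply: fpsP => n /=; rewrite if_same add0r. Qed.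
Lemma fps_addN : left_inverse (fps_const 0) fps_opp fps_add.
Proof. by move=> f; apply: fpsP => n /=; rewrite if_same addNr. Qed.

HB.instance Definition _ :=
  GRing.isZmodule.Build (fps R) fps_addA fps_addC fps_add0 fps_addN.

(* Truncation to a polynomial; it transfers the multiplicative laws. *)
Definition fps_trunc m f : {poly R} := \poly_(i < m) fps_coef f i.

Lemma fps_coef_mul m n f g : (n < m)%N ->
  fps_coef (fps_mul f g) n = (fps_trunc m f * fps_trunc m g)`_n.
Proof.
move=> nm; rewrite coefM /=; apply: eq_bigr => i _; rewrite !coef_poly.
by rewrite (leq_ltn_trans (leq_subr i n) nm) (leq_ltn_trans _ nm) // -ltnS.
Qed.

Lemma fps_mulC : commutative fps_mul.
Proof.
by move=> f g; apply: fpsP => n; rewrite !(@fps_coef_mul n.+1) // mulrC.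
Qed.

Lemma fps_mulA : associative fps_mul.
Proof.
move=> f g h; apply: fpsP => n.
transitivity ((fps_trunc n.+1 f * (fps_trunc n.+1 g * fps_trunc n.+1 h))`_n).
  rewrite [RHS]coefM /=; apply: eq_bigr => i _.
  by rewrite coef_poly ltn_ord -(@fps_coef_mul n.+1) // ltnS leq_subr.
rewrite mulrA [LHS]coefM /=; apply: eq_bigr => i _.
by rewrite coef_poly ltnS leq_subr -(@fps_coef_mul n.+1).
Qed.

Lemma fps_mul1 : left_id (fps_const 1) fps_mul.
Proof.
move=> f; apply: fpsP => n /=.
rewrite big_ord_recl /= mul1r subn0 big1 ?addr0 // => i _.
by rewrite mul0r.
Qed.

Lemma fps_mulDl : left_distributive fps_mul fps_add.
Proof.
move=> f g h; apply: fpsP => n /=; rewrite -big_split /=.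
by apply: eq_bigr => i _; rewrite mulrDl.
Qed.

Lemma fps_oner_neq0 : fps_const 1 != 0.
Proof.
by apply/eqP => /(congr1 (fun f => fps_coef f 0)) /eqP; rewrite /= oner_eq0.
Qed.

HB.instance Definition _ := GRing.Zmodule_isComNzRing.Build (fps R)
  fps_mulA fps_mulC fps_mul1 fps_mulDl fps_oner_neq0.

End FpsRing.

Section FpsUnit.
Variable R : comUnitRingType.
Implicit Types f g : fps R.

Definition fps_unit f : bool := fps_coef f 0 \is a GRing.unit.

(* The first n + 1 coefficients of the inverse, by solving f * g = 1
   degree by degree. *)
Fixpoint fps_inv_seq f n : seq R :=
  if n is m.+1 then
    let s := fps_inv_seq f m in
    rcons s (- (fps_coef f 0)^-1 * \sum_(i < n) fps_coef f (n - i)%N * s`_i)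
  else [:: (fps_coef f 0)^-1].

(* Non-units are sent to themselves, as the unit ring interface requires of _^-1. *)
Definition fps_inv f : fps R :=
  if fps_unit f then FPS (fun n => (fps_inv_seq f n)`_n) else f.

Lemma size_fps_inv_seq f n : size (fps_inv_seq f n) = n.+1.
Proof. by elim: n => //= n IHn; rewrite size_rcons IHn. Qed.

Lemma nth_fps_inv_seq f n i : (i <= n)%N ->
  (fps_inv_seq f n)`_i = (fps_inv_seq f i)`_i.
Proof.
elim: n => [|n IHn]; first by rewrite leqn0 => /eqP->.
rewrite leq_eqVlt => /predU1P[-> //|lt_in].
by rewrite /= nth_rcons size_fps_inv_seq lt_in IHn.
Qed.

Lemma fps_mulVf : {in fps_unit, left_inverse 1 fps_inv *%R}.
Proof.
move=> f uf; have {}uf : fps_unit f by [].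
have uf0 : fps_coef f 0 \is a GRing.unit by [].
rewrite mulrC /fps_inv uf; apply: fpsP => -[|n] /=.
  by rewrite big_ord1 /= mulrV.
rewrite big_ord_recl subn0 /= nth_rcons size_fps_inv_seq ltnn eqxx.
rewrite mulNr mulrN mulVKr //.
apply/eqP; rewrite addrC subr_eq0 (reindex_inj rev_ord_inj) /=; apply/eqP.
apply: eq_bigr => i _; have le_in : (i <= n)%N by rewrite -ltnS.
by rewrite /bump /= add1n !subSS subKn // subSn // (nth_fps_inv_seq f le_in).
Qed.

Lemma fps_unitPl f g : g * f = 1 -> fps_unit f.
Proof.
move=> /(congr1 (fun h => fps_coef h 0)); rewrite /= big_ord1 => gf1.
by apply/unitrP; exists (fps_coef g 0); rewrite [_ * fps_coef g 0]mulrC.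
Qed.

Lemma fps_inv_out : {in [predC fps_unit], fps_inv =1 id}.
Proof. by move=> f /negPf uf; rewrite /fps_inv -[fps_unit f]/(f \in fps_unit) uf. Qed.

HB.instance Definition _ := GRing.ComNzRing_hasMulInverse.Build (fps R)
  fps_mulVf fps_unitPl fps_inv_out.

End FpsUnit.

(* Z[[x, y, q]], iterated as Z[[x]][[y]][[q]]. *)
Definition fps3 : comUnitRingType := fps (fps (fps int)).

Definition var_x : fps3 := fps_const (fps_const (fps_var int)).
Definition var_y : fps3 := fps_const (fps_var (fps int)).
Definition var_q : fps3 := fps_var (fps (fps int)).

(* coef3 F a b n is the coefficient of x^a y^b q^n in F. *)
Definition coef3 (F : fps3) (a b n : nat) : int :=
  fps_coef (fps_coef (fps_coef F n) b) a.

Local Open Scope classical_set_scope.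

(* A family of power series indexed by A can be summed formally when each
   monomial occurs in finitely many of its members; its sum is then taken
   monomial by monomial. The finitely supported sum over i \in A below is 0
   by convention when infinitely many terms are nonzero, hence summable3. *)
Definition summable3 (I : choiceType) (A : set I) (F : I -> fps3) : Prop :=
  forall a b n, finite_set [set i | A i /\ coef3 (F i) a b n != 0].

Definition sum3 (I : choiceType) (A : set I) (F : I -> fps3) : fps3 :=
  FPS (fun n => FPS (fun b => FPS (fun a =>
    \sum_(i \in A) coef3 (F i) a b n))).

Definition is_partition (s : seq nat) : bool :=
  sorted geq s && all (fun k => 0 < k)%N s.

Definition partitions : set (seq nat) :=
  [set s | is_partition s /\ s <> [::]].
Definition distinct_partitions : set (seq nat) :=
  [set s | partitions s /\ uniq s].
Definition odd_partitions : set (seq nat) :=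
  [set s | partitions s /\ all odd s].

Definition largest_part (s : seq nat) : nat := head 0%N s.
Definition num_parts (s : seq nat) : nat := size s.
Definition largest_hook (s : seq nat) : nat :=
  (largest_part s + num_parts s - 1)%N.

Definition partition_term (s : seq nat) : fps3 :=
  var_x ^+ largest_part s * var_y ^+ num_parts s * var_q ^+ largest_hook s.

(* Main.v *)
(** Every partition in the class except (1) is obtained from a unique smaller
    one by exactly one of two moves, each of which multiplies the weight by a
    fixed monomial. For P: increase the largest part by 1 (weight xq) or repeat
    it (yq). For D: increase the largest part h by 1 (xq) or add a new part
    h + 1 (xyq^2). For O: increase the largest part by 2 (x^2 q^2) or repeat it
    (yq). Hence the sum S satisfies S = xyq + (u + v) S, with u, v the weights
    of the two moves. *)
Require Import Defs.
From mathcomp Require Import all_boot all_order all_algebra.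
From mathcomp Require Import boolp classical_sets cardinality fsbigop.
From mathcomp Require Import functions.

Set Implicit Arguments.
Unset Strict Implicit.
Unset Printing Implicit Defensive.

Import GRing.Theory.
Local Open Scope ring_scope.
Local Open Scope classical_set_scope.

(** * Coefficients of series and monomials in x, y, q *)

Lemma fps_coef0 (R : comNzRingType) n : fps_coef (0 : fps R) n = 0.
Proof. exact: if_same. Qed.

Lemma fps_coef_varM (R : comNzRingType) (f : fps R) n :
  fps_coef (fps_var R * f) n = if n is m.+1 then fps_coef f m else 0.
Proof.
case: n => [|n] /=; first by rewrite big_ord1 /= mul0r.
rewrite big_ord_recl mul0r add0r big_ord_recl /= mul1r subSS subn0.
by rewrite big1 ?addr0 // => i _; rewrite mul0r.
Qed.

Lemma fps_coef_constM (R : comNzRingType) (c : R) (f : fps R) n :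
  fps_coef (fps_const c * f) n = c * fps_coef f n.
Proof.
by rewrite /= big_ord_recl subn0 /= big1 ?addr0 // => i _; rewrite mul0r.
Qed.

Lemma fps3P (F G : fps3) :
  (forall a b n, coef3 F a b n = coef3 G a b n) -> F = G.
Proof. by move=> FG; do 3![apply: fpsP => ?]; apply: FG. Qed.

Lemma coef3_xM (F : fps3) a b n :
  coef3 (var_x * F) a b n = if a is c.+1 then coef3 F c b n else 0.
Proof. by rewrite /coef3 !fps_coef_constM fps_coef_varM. Qed.

Lemma coef3_yM (F : fps3) a b n :
  coef3 (var_y * F) a b n = if b is c.+1 then coef3 F a c n else 0.
Proof.
rewrite /coef3 fps_coef_constM fps_coef_varM; case: b => //.
by rewrite fps_coef0.
Qed.

Lemma coef3_qM (F : fps3) a b n :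
  coef3 (var_q * F) a b n = if n is c.+1 then coef3 F a b c else 0.
Proof.
by rewrite /coef3 fps_coef_varM; case: n => //; rewrite !fps_coef0.
Qed.

Definition monom i j k : fps3 := var_x ^+ i * var_y ^+ j * var_q ^+ k.

Lemma monomM i j k i' j' k' :
  monom (i + i') (j + j') (k + k') = monom i j k * monom i' j' k'.
Proof. by rewrite /monom !exprD [X in X * _ = _]mulrACA [LHS]mulrACA. Qed.

Lemma monom_ind (Q : fps3 -> Prop) :
  Q 1 -> (forall F, Q F -> Q (var_x * F)) -> (forall F, Q F -> Q (var_y * F)) ->
  (forall F, Q F -> Q (var_q * F)) -> forall i j k, Q (monom i j k).
Proof.
move=> Q1 Qx Qy Qq i j k; rewrite /monom -mulrA.
elim: i => [|i IHi]; last by rewrite exprS -mulrA; apply: Qx.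
rewrite mul1r; elim: j => [|j IHj]; last by rewrite exprS -mulrA; apply: Qy.
by rewrite mul1r; elim: k => [//|k IHk]; rewrite exprS; apply: Qq.
Qed.

Lemma coef3_monom i j k a b n :
  coef3 (monom i j k) a b n = [&& a == i, b == j & n == k]%:R.
Proof.
rewrite /monom -mulrA; elim: i a => [|i IHi] a; last first.
  by rewrite exprS -mulrA coef3_xM; case: a => [|a] //; rewrite IHi.
rewrite mul1r; elim: j b => [|j IHj] b; last first.
  by rewrite exprS -mulrA coef3_yM; case: b => [|b] //; rewrite ?IHj // andbF.
rewrite mul1r; elim: k n => [|k IHk] n; last first.
  by rewrite exprS coef3_qM; case: n => [|n] //; rewrite ?IHk // !andbF.
by rewrite /coef3; case: a b n => [|a] [|b] [|n].
Qed.

(** A multiple of the variable has zero constant term, so the constant term here is 1, and a series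
    is invertible as soon as its constant term is. *)
Lemma fps_unit_1_sub_varM (R : comUnitRingType) (f : fps R) :
  1 - f * fps_var R \is a GRing.unit.
Proof.
have -> : (1 - f * fps_var R \is a GRing.unit) = fps_unit (1 - f * fps_var R).
  by [].
have -> : fps_unit (1 - f * fps_var R) =
    (fps_coef (1 : fps R) 0 - fps_coef (f * fps_var R) 0 \is a GRing.unit).
  by [].
by rewrite mulrC fps_coef_varM subr0 [fps_coef _ 0]/(1 : R) unitr1.
Qed.

(** * Formal sums of families of series *)

Section Sum3.
Variable I : choiceType.
Implicit Types (A B : set I) (F : I -> fps3).

Lemma coef3_sum3 A F a b n :
  coef3 (sum3 A F) a b n = \sum_(i \in A) coef3 (F i) a b n.
Proof. by []. Qed.

(** Multiplying by one variable shifts coefficients by one, uniformly in the family: each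
    coefficient of the sum is either zero term by term or a shifted one. *)
Lemma sum3_monomM A F i j k :
  sum3 A (fun s => monom i j k * F s) = monom i j k * sum3 A F.
Proof.
move: i j k.
pose Q (c : fps3) := forall G, sum3 A (fun s => c * G s) = c * sum3 A G.
suff: forall i j k, Q (monom i j k) by move=> + i j k; apply.
(* Since [Q] quantifies over all families, it is stable under products, which leaves only the three
   variables to check. *)
have QM c d : Q c -> Q d -> Q (c * d).
  move=> Qc Qd G; rewrite -mulrA -Qd -Qc; congr sum3.
  by apply: funext => s; rewrite mulrA.
apply: monom_ind => [G|c|c|c].
- by rewrite mul1r; congr sum3; apply: funext => s; rewrite mul1r.
- apply: QM => G; apply: fps3P => a b n; rewrite coef3_xM coef3_sum3.
  case: a => [|a]; first by rewrite fsbig1 // => s _; rewrite coef3_xM.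
  by apply: eq_fsbigr => s _; rewrite coef3_xM.
- apply: QM => G; apply: fps3P => a b n; rewrite coef3_yM coef3_sum3.
  case: b => [|b]; first by rewrite fsbig1 // => s _; rewrite coef3_yM.
  by apply: eq_fsbigr => s _; rewrite coef3_yM.
- apply: QM => G; apply: fps3P => a b n; rewrite coef3_qM coef3_sum3.
  case: n => [|n]; first by rewrite fsbig1 // => s _; rewrite coef3_qM.
  by apply: eq_fsbigr => s _; rewrite coef3_qM.
Qed.

Lemma sub_summable3 A B F : A `<=` B -> summable3 B F -> summable3 A F.
Proof.
move=> AB sB a b n; apply: sub_finite_set (sB a b n).
by move=> s [/AB].
Qed.

(** Summability makes the support of each coefficient finite, so no sum falls back to its default
    value 0 and the supports can be split. *)
Lemma sum3_setU A B F : summable3 (A `|` B) F -> A `&` B `<=` set0 ->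
  sum3 (A `|` B) F = sum3 A F + sum3 B F.
Proof.
move=> sAB AB0; apply: fps3P => a b n.
set supp := (fun s => coef3 (F s) a b n) @^-1` [set~ 0].
have supp_fin C : C `<=` A `|` B -> finite_set (C `&` supp).
  move=> /sub_summable3/(_ sAB)/(_ a b n).
  by apply: sub_finite_set => s [Cs /eqP].
rewrite [RHS]/(coef3 (sum3 A F) a b n + coef3 (sum3 B F) a b n) !coef3_sum3.
have supp_eq C : \sum_(s \in C) coef3 (F s) a b n =
    \sum_(s \in C `&` supp) coef3 (F s) a b n by exact: fsbig_supp.
rewrite (supp_eq (A `|` B)) (supp_eq A) (supp_eq B) setIUl fsbigU0 //.
- exact/supp_fin/subsetUl.
- exact/supp_fin/subsetUr.
- by move=> s [[As _] [Bs _]]; apply: AB0.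
Qed.

Lemma sum3_set1 F s : sum3 [set s] F = F s.
Proof. by apply: fps3P => a b n; rewrite coef3_sum3 fsbig_set1. Qed.

Lemma sum3_image A F (h : I -> I) : set_inj A h ->
  sum3 (h @` A) F = sum3 A (F \o h).
Proof.
by move=> inj_h; apply: fps3P => a b n; rewrite !coef3_sum3 fsbig_image.
Qed.

(** The hypotheses make [A] the disjoint union of [s0] and two injective images of itself. The
    successors in the exponents of q make both weights multiples of q, hence [1 - u] invertible. *)
Lemma sum3_recursion A F (s0 : I) (f g : I -> I) i j k i' j' k' :
  summable3 A F ->
  A = [set s0] `|` (f @` A `|` g @` A) ->
  {in A, forall s, f s <> s0 /\ g s <> s0} ->
  {in A &, forall s t, f s <> g t} ->
  set_inj A f -> set_inj A g ->
  {in A, forall s, F (f s) = monom i j k.+1 * F s} ->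
  {in A, forall s, F (g s) = monom i' j' k'.+1 * F s} ->
  sum3 A F = F s0 / (1 - (monom i j k.+1 + monom i' j' k'.+1)).
Proof.
move=> sA A_eq not_s0 not_fg inj_f inj_g Ff Fg.
set u := monom i j _ + _.
have u_unit : 1 - u \is a GRing.unit.
  by rewrite /u /monom !exprSr !mulrA -mulrDl fps_unit_1_sub_varM.
(* Clearing the denominator turns the goal into S = F s0 + S u. *)
apply: (mulIr u_unit); rewrite divrK // mulrBr mulr1.
apply/eqP; rewrite subr_eq; apply/eqP.
have sA' := sA; rewrite A_eq in sA'.
rewrite {1}A_eq sum3_setU //; last first.
  by move=> _ [-> [] [t /mem_set/not_s0[]]].
rewrite sum3_set1 sum3_setU; first last.
- move=> _ [[s As <-] [t At]] /esym.
  by apply: not_fg; apply: mem_set.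
- exact: sub_summable3 sA'.
rewrite !sum3_image // mulrC /u mulrDl -!sum3_monomM.
by congr (_ + (_ + _)); apply: fps3P => a b n; apply: eq_fsbigr => s As /=;
  rewrite ?Ff ?Fg.
Qed.

End Sum3.

(** * Summability of the weights and the two moves on partitions *)

Lemma partition_termE s :
  partition_term s = monom (largest_part s) (num_parts s) (largest_hook s).
Proof. by []. Qed.

(** A nonzero coefficient at x^a y^b forces b parts, the largest being a. Such a partition is a
    [b]-tuple with entries at most [a], and there are finitely many of these. *)
Lemma summable3_partition_term (A : set (seq nat)) :
  A `<=` partitions -> summable3 A partition_term.
Proof.
move=> AP a b n.
apply: (@sub_finite_set _ _
  [set [seq val k | k <- val t] | t in [set: b.-tuple 'I_a.+1]]); last first.
  exact/finite_image/finite_finset.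
move=> s [/AP[/andP[s_sorted _] _]]; rewrite coef3_monom.
case: and3P => // -[/eqP a_eq /eqP b_eq _] _.
have s_le k : k \in s -> (k < a.+1)%N.
  case: s s_sorted a_eq {b_eq} => //= h t.
  rewrite (path_sortedE (rev_trans leq_trans)) ltnS => /andP[/allP h_max _] ->.
  by rewrite inE => /predU1P[-> //|/h_max].
have size_s : size [seq inord k : 'I_a.+1 | k <- s] == b.
  by rewrite size_map b_eq.
exists (Tuple size_s) => //=; rewrite -map_comp -[RHS]map_id.
by apply/eq_in_map => k /s_le /= k_lt; rewrite inordK.
Qed.

Lemma partition_cons h t :
  is_partition (h :: t) =
  [&& (0 < h)%N, (head 0 t <= h)%N & is_partition t].
Proof.
case: t => [|k t]; first by rewrite /is_partition /= andbT.
by rewrite /is_partition /= andbCA -!andbA.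
Qed.

(** In a non-increasing list a later copy of [h] squeezes the second entry to [h], so only
    neighbours need comparing. The default head 0 covers an empty tail because [h] is positive. *)
Lemma uniq_partition_cons h t : is_partition (h :: t) ->
  uniq (h :: t) = (head 0 t < h)%N && uniq t.
Proof.
rewrite partition_cons => /and3P[h_gt0 ht pt] /=; congr (_ && _).
case: t ht pt => [|k t] //= kh; rewrite inE ltn_neqAle kh andbT eq_sym.
rewrite /is_partition /= (path_sortedE (rev_trans leq_trans)).
case/andP=> /andP[/allP k_max _] _; rewrite negb_or.
case: eqVneq => //= k_neq_h; apply/negP => /k_max /= hk.
by move: k_neq_h; rewrite eqn_leq kh hk.
Qed.

Definition bump_head m (s : seq nat) := (head 0 s + m)%N :: behead s.
(** The value m = 0 repeats the largest part; m = 1 adds a new part one larger. *)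
Definition push_head m (s : seq nat) := (head 0 s + m)%N :: s.

Lemma bump_head_inj m (A : set (seq nat)) :
  A `<=` partitions -> set_inj A (bump_head m).
Proof.
move=> AP s t /set_mem/AP[_ s_nnil] /set_mem/AP[_ t_nnil].
by case: s s_nnil => // h s _; case: t t_nnil => // k t _ [/addIn-> ->].
Qed.

Lemma push_head_inj m (A : set (seq nat)) : set_inj A (push_head m).
Proof. by move=> s t _ _ []. Qed.

Lemma partition_term_bump_head m s : s <> [::] ->
  partition_term (bump_head m s) = monom m 0 m * partition_term s.
Proof.
case: s => // h t _; rewrite !partition_termE -monomM add0n.
have -> : largest_part (bump_head m (h :: t)) = (m + h)%N by exact: addnC.
suff -> : largest_hook (bump_head m (h :: t)) = (m + largest_hook (h :: t))%N.
  by [].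
by rewrite /largest_hook /num_parts /= !addnS !subn1 /= addnAC addnC.
Qed.

Lemma partition_term_push_head m s : s <> [::] ->
  partition_term (push_head m s) = monom m 1 m.+1 * partition_term s.
Proof.
case: s => // h t _; rewrite !partition_termE -monomM add1n.
have -> : largest_part (push_head m (h :: t)) = (m + h)%N by exact: addnC.
suff -> : largest_hook (push_head m (h :: t)) =
    (m.+1 + largest_hook (h :: t))%N by [].
rewrite /largest_hook /num_parts /= !addnS !subn1 /= addnAC addnC.
by rewrite addSn.
Qed.

(** Reduces each of the three identities to combinatorial facts: the class is closed under the
    moves, generated by them from (1), and no partition arises from both moves. *)
Lemma sum3_partition_recursion (A : set (seq nat)) m p :
  A `<=` partitions -> A [:: 1%N] ->
  (forall s, A s -> A (bump_head m.+1 s) /\ A (push_head p s)) ->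
  (forall s, A s -> s = [:: 1%N] \/
    exists t, A t /\ (s = bump_head m.+1 t \/ s = push_head p t)) ->
  (forall s t, A s -> A t -> bump_head m.+1 s <> push_head p t) ->
  sum3 A partition_term =
    var_x * var_y * var_q / (1 - (monom m.+1 0 m.+1 + monom p 1 p.+1)).
Proof.
move=> AP A1 A_closed A_gen A_disj.
have nnil s : A s -> s <> [::] by case/AP.
rewrite (@sum3_recursion _ A partition_term [:: 1%N]
  (bump_head m.+1) (push_head p) m.+1 0 m p 1 p) //.
- exact: summable3_partition_term.
- apply/seteqP; split=> s.
    case/A_gen => [-> | [t [At [->|->]]]]; first by left.
      by right; left; exists t.
    by right; right; exists t.
  by case=> [-> // | [] [t /A_closed[At At'] <-]].
(* A bumped head is at least 2 since [h] is positive, and a pushed list has at least two parts, so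
   neither is (1). *)
- move=> s /set_mem/[dup] /AP[+ _] /nnil; case: s => // h s.
  rewrite partition_cons => /andP[h_gt0 _] _; split; last by [].
  by case; case: h h_gt0 => // h _; rewrite addnS.
- by move=> s t /set_mem As /set_mem At; apply: A_disj.
- exact: bump_head_inj.
- exact: push_head_inj.
- by move=> s /set_mem/nnil; apply: partition_term_bump_head.
- by move=> s /set_mem/nnil; apply: partition_term_push_head.
Qed.

(** * The three classes: all, distinct and odd parts *)

Lemma sum3_partitions :
  sum3 partitions partition_term =
    var_x * var_y * var_q / (1 - (monom 1 0 1 + monom 0 1 1)).
Proof.
apply: sum3_partition_recursion => //.
- case=> [|h s] [ps //= _]; split; split=> //; move: ps.
    by rewrite !partition_cons /= addn1 => /and3P[_ /leqW-> ->].
  by rewrite !partition_cons /= addn0 leqnn => /and3P[-> -> ->].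
- case=> [|h s] [] //; rewrite partition_cons => /and3P[h_gt0 sh ps] _.
  (* If the two largest parts agree, the last move was a repetition; otherwise the head can be
     lowered, except in (1). *)
  have [sh_eq|sh_neq] := eqVneq (head 0 s) h.
    right; exists s; split; last by right; rewrite /push_head addn0 sh_eq.
    by split=> //; case: s sh_eq h_gt0 {sh ps} => //= <-.
  have {sh_neq} sh : (head 0 s < h)%N by rewrite ltn_neqAle sh_neq.
  case: h h_gt0 sh => // -[_ sh|h _ sh].
    by left; move: sh ps; case: s => //= k s; rewrite partition_cons; case: k.
  right; exists (h.+1 :: s); split; last by left; rewrite /bump_head /= addn1.
  by split=> //; rewrite partition_cons ps andbT.
(* A coincidence would give [h :: s] the second part [k], equal to [h + 1], against monotonicity. *)
- move=> [|h s] [|k t] [ps _] [pt _] // [+ st]; rewrite addn0 addn1 => kh.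
  by move: ps; rewrite partition_cons st /= -kh ltnn andbF.
Qed.

Lemma sum3_distinct_partitions :
  sum3 distinct_partitions partition_term =
    var_x * var_y * var_q / (1 - (monom 1 0 1 + monom 1 1 2)).
Proof.
apply: sum3_partition_recursion => //; first by move=> s [].
- case=> [|h s] [[] // ps _ us].
  move: us; rewrite uniq_partition_cons // => /andP[sh us].
  move: ps; rewrite partition_cons => /and3P[h_gt0 _ ps].
  have pbump : is_partition (bump_head 1 (h :: s)).
    by rewrite partition_cons /= addn1 (leqW (ltnW sh)).
  have ppush : is_partition (push_head 1 (h :: s)).
    by rewrite !partition_cons /= addn1 leqnSn h_gt0 (ltnW sh).
  split; split=> //.
    by rewrite uniq_partition_cons //= addn1 ltnS (ltnW sh).
  rewrite uniq_partition_cons //= addn1 ltnSn.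
  rewrite -/(uniq (h :: s)) uniq_partition_cons ?sh //.
  by rewrite partition_cons h_gt0 (ltnW sh).
- case=> [|h s] [[] //] phs _; rewrite uniq_partition_cons // => /andP[sh us].
  move: phs; rewrite partition_cons => /and3P[h_gt0 _ ps].
  (* With head [h.+1], a second part equal to [h] means the head was pushed; a smaller one leaves
     room to lower the head. For empty [s] the default head 0 makes the equality case exactly
     (1). *)
  case: h sh h_gt0 => // h; rewrite ltnS leq_eqVlt => /predU1P[sh_eq|sh] _.
    case: s sh_eq us ps => [/= <- _ _|k s kh us ps]; first by left.
    right; exists (k :: s); split=> //.
    by right; rewrite /push_head -kh /= addn1.
  have phs : is_partition (h :: s).
    by rewrite partition_cons (ltnW sh) ps (leq_ltn_trans _ sh).
  right; exists (h :: s); split; last by left; rewrite /bump_head /= addn1.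
  by split=> //; rewrite uniq_partition_cons // sh.
(* A coincidence would make [s] begin with [k = h], repeating a part. *)
- move=> [|h s] [|k t] [[ps _] us] [[pt _] ut] // [+ st].
  rewrite !addn1 => -[hk].
  by move: us; rewrite uniq_partition_cons // st hk ltnn.
Qed.

Lemma sum3_odd_partitions :
  sum3 odd_partitions partition_term =
    var_x * var_y * var_q / (1 - (monom 2 0 2 + monom 0 1 1)).
Proof.
apply: sum3_partition_recursion => //; first by move=> s [].
- case=> [|h s] [[ps //= _] /andP[oh os]].
  move: ps; rewrite partition_cons => /and3P[h_gt0 sh ps].
  split; split=> //; first split=> //.
  + by rewrite partition_cons /= addn2 ps (leq_trans sh) // ltnW.
  + by rewrite /= addn2 /= negbK oh.
  + by split=> //; rewrite !partition_cons /= addn0 leqnn h_gt0 sh.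
  + by rewrite /= addn0 oh.
- case=> [|h s] [[] //]; rewrite partition_cons => /and3P[h_gt0 sh ps] _.
  move=> /= /andP[oh os].
  have [sh_eq|sh_neq] := eqVneq (head 0 s) h.
    right; exists s; split; last by right; rewrite /push_head addn0 sh_eq.
    by split=> //; split=> //; case: s sh_eq h_gt0 {sh ps os} => //= <-.
  have {sh_neq} sh : (head 0 s < h)%N by rewrite ltn_neqAle sh_neq.
  (* Head 1 leaves only an empty tail, parity excludes head 2, and a head of at least 3 can be
     lowered by 2. *)
  case: h h_gt0 oh sh => // -[_ _ sh|[//|h] _ oh sh].
    left; move: sh ps; case: s {os} => //= k s.
    by rewrite partition_cons; case: k.
  have {}oh : odd h.+1 by move: oh; rewrite /= !negbK.
  right; exists (h.+1 :: s); split; last by left; rewrite /bump_head /= addn2.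
  split; last by rewrite /= os andbT.
  split=> //; rewrite partition_cons ps andbT /=.
  (* A head of [s] equal to [h.+2] would be even. *)
  case: s os sh {ps} => //= k s /andP[ok _].
  rewrite ltnS leq_eqVlt => /predU1P[k_eq|//].
  by move: ok oh; rewrite k_eq /= negbK => ->.
(* As for all partitions, the second part of [h :: s] would exceed its head, now by 2. *)
- move=> [|h s] [|k t] [[ps _] _] [[pt _] _] // [+ st].
  rewrite addn0 addn2 => kh.
  by move: ps; rewrite partition_cons st /= -kh (ltnNge h.+1) leqnSn andbF.
Qed.

Theorem theorem2p3 :
  [/\ summable3 partitions partition_term /\
      sum3 partitions partition_term
        = (var_x * var_y * var_q) / (1 - (var_x * var_q + var_y * var_q)),
      summable3 distinct_partitions partition_term /\
      sum3 distinct_partitions partition_term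
        = (var_x * var_y * var_q)
            / (1 - (var_x * var_q + var_x * var_y * var_q ^+ 2)) &
      summable3 odd_partitions partition_term /\
      sum3 odd_partitions partition_term
        = (var_x * var_y * var_q)
            / (1 - (var_y * var_q + var_x ^+ 2 * var_q ^+ 2))].
Proof.
have xq k : monom k 0 k = var_x ^+ k * var_q ^+ k by rewrite /monom mulr1.
have yq : monom 0 1 1 = var_y * var_q by rewrite /monom mul1r.
split; split; try by apply: summable3_partition_term => // s [].
- by rewrite sum3_partitions xq yq.
- by rewrite sum3_distinct_partitions xq.
- by rewrite sum3_odd_partitions xq yq [var_y * _ + _]addrC.
Qed.
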